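(* Suppose $\mathcal{Y}=\mathbb{R}^n$, and each $f_i$ is strongly convex with constant $\mu_i>0$ and differentiable with $\nabla f_i$ Lipschitz continuous on $\mathbb{R}^n$ with constant $L_i>0$, $i=1,\dots,m$. Let $\mu=\min_i\mu_i$, $L=\max_iL_i$, $L_h=(1/\mu)(2+2\cos(\pi/m))$, $\mu_h=(1/L)(2-2\cos(\pi/m))$, $h=-g$, and let $\boldsymbol{\lambda}^\star$ be a dual optimal solution, i.e. a maximizer of $g$. Let $\{\boldsymbol{\lambda}^{(k)}\}_{k\ge0}$ be generated by the inexact dual algorithm with distortions satisfying $\|\mathbf{r}_i^{(k)}\|\le\varepsilon_i$ for all $i,k$ and with stepsizes satisfying $0<\gamma_k\le1/L_h$ for all $k\ge0$. Then for every $k\ge0$, $$h(\boldsymbol{\lambda}^{(k+1)})-h(\boldsymbol{\lambda}^\star)\le(1-\gamma_k\mu_h)\left(h(\boldsymbol{\lambda}^{(k)})-h(\boldsymbol{\lambda}^\star)\right)+\frac{\gamma_k\epsilon^2}{2}.$$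
   Context: Let $m\ge2$, $n\ge1$ be integers, $\mathcal{Y}\subseteq\mathbb{R}^n$ a closed convex set, and $f_i:\mathbb{R}^n\to\mathbb{R}$, $i=1,\dots,m$, strictly convex closed functions. For $\mathbf{y}=(\mathbf{y}_1,\dots,\mathbf{y}_m)\in(\mathbb{R}^n)^m=\mathbb{R}^{nm}$ put $f(\mathbf{y})=\sum_{i=1}^m f_i(\mathbf{y}_i)$, let $\bar{\mathcal{Y}}=\mathcal{Y}^m$, and $\mathbf{A}\mathbf{y}=(\mathbf{y}_1-\mathbf{y}_2,\dots,\mathbf{y}_{m-1}-\mathbf{y}_m)\in\mathbb{R}^{n(m-1)}$. The dual function is $g(\boldsymbol{\lambda})=\inf_{\mathbf{y}\in\bar{\mathcal{Y}}}\big[f(\mathbf{y})+\boldsymbol{\lambda}^{T}\mathbf{A}\mathbf{y}\big]$, $\boldsymbol{\lambda}\in\mathbb{R}^{n(m-1)}$. Inexact dual algorithm: start from any $\boldsymbol{\lambda}^{(0)}\in\mathbb{R}^{n(m-1)}$; for $k=0,1,2,\dots$ let $\mathbf{y}^{(k)}=\arg\min_{\mathbf{y}\in\bar{\mathcal{Y}}}\big[f(\mathbf{y})+(\boldsymbol{\lambda}^{(k)})^{T}\mathbf{A}\mathbf{y}\big]$, let $\hat{\mathbf{y}}_i^{(k)}=\mathbf{y}_i^{(k)}+\mathbf{r}_i^{(k)}$ where $\mathbf{r}_i^{(k)}\in\mathbb{R}^n$ are arbitrary distortions, let $\hat{\mathbf{d}}^{(k)}=\mathbf{A}\hat{\mathbf{y}}^{(k)}$,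 and set $\boldsymbol{\lambda}^{(k+1)}=\boldsymbol{\lambda}^{(k)}+\gamma_k\hat{\mathbf{d}}^{(k)}$. The distortions are bounded by constants: $\|\mathbf{r}_i^{(k)}\|\le\varepsilon_i$ for all $i$ and $k$, and $\epsilon:=\sqrt{\sum_{i=1}^{m-1}(\varepsilon_i+\varepsilon_{i+1})^2}$. Norms are Euclidean. A function $\varphi$ is strongly convex with constant $\sigma>0$ if $\varphi-\frac{\sigma}{2}\|\cdot\|^2$ is convex. *)

(* Defs.v *)
From HB Require Import structures.
From mathcomp Require Import all_boot all_order all_algebra.
From mathcomp Require Import all_classical all_reals all_analysis.
Set Implicit Arguments.
Unset Strict Implicit.
Unset Printing Implicit Defensive.
Import Order.TTheory GRing.Theory Num.Theory.
Import numFieldNormedType.Exports.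
Local Open Scope classical_set_scope.
Local Open Scope ring_scope.

(* An element (y_1, ..., y_p) of (R^n)^p is a matrix 'M[R]_(p, n) whose i-th row
   is y_i; [dotp] and [enorm] are the Euclidean structure of R^(n p).  The
   library norm `|x| on matrices is the sup norm, hence [enorm]. *)
Definition dotp (R : realType) (p n : nat) (u v : 'M[R]_(p, n)) : R :=
  \sum_(i < p) \sum_(j < n) u i j * v i j.

Definition enorm (R : realType) (p n : nat) (u : 'M[R]_(p, n)) : R :=
  Num.sqrt (dotp u u).

Definition strictly_convex (R : realType) (n : nat) (phi : 'rV[R]_n -> R) : Prop :=
  forall (t : R) (x y : 'rV[R]_n), 0 < t -> t < 1 -> x <> y ->
    phi (t *: x + (1 - t) *: y) < t * phi x + (1 - t) * phi y.

Definition closed_function (R : realType) (n : nat) (phi : 'rV[R]_n -> R) : Prop :=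
  closed [set p : 'rV[R]_n * R | phi p.1 <= p.2].

Definition strongly_convex (R : realType) (n : nat) (sigma : R)
    (phi : 'rV[R]_n -> R) : Prop :=
  convex_function setT (fun x : 'rV[R]_n => phi x - sigma / 2 * enorm x ^+ 2).

Definition grad (R : realType) (n : nat) (phi : 'rV[R]_n -> R) (x : 'rV[R]_n) :
    'rV[R]_n :=
  \row_j 'D_(delta_mx 0 j) phi x.

Definition lipschitz_grad (R : realType) (n : nat) (L : R)
    (phi : 'rV[R]_n -> R) : Prop :=
  forall x y : 'rV[R]_n, enorm (grad phi x - grad phi y) <= L * enorm (x - y).

Lemma ord_hi_proof (m : nat) (i : 'I_m.-1) : (i.+1 < m)%N.
Proof. by case: m i => [|m] [i /=]. Qed.

(* For i : 'I_m.-1, the indices i and i + 1 in 'I_m. *)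
Definition ord_lo (m : nat) (i : 'I_m.-1) : 'I_m := widen_ord (leq_pred m) i.
Definition ord_hi (m : nat) (i : 'I_m.-1) : 'I_m := Ordinal (ord_hi_proof i).

Definition Aop (R : realType) (m n : nat) (y : 'M[R]_(m, n)) : 'M[R]_(m.-1, n) :=
  \matrix_(i, j) (y (ord_lo i) j - y (ord_hi i) j).

Definition lagrangian (R : realType) (m n : nat) (f : 'I_m -> 'rV[R]_n -> R)
    (lam : 'M[R]_(m.-1, n)) (y : 'M[R]_(m, n)) : R :=
  \sum_(i < m) f i (row i y) + dotp lam (Aop y).

Definition power_set_m (R : realType) (m n : nat) (Y : set 'rV[R]_n) :
    set 'M[R]_(m, n) :=
  [set y | forall i, Y (row i y)].

(* The infimum is taken in the extended reals, so no boundedness is presupposed. *)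
Definition dual_fun (R : realType) (m n : nat) (Y : set 'rV[R]_n)
    (f : 'I_m -> 'rV[R]_n -> R) (lam : 'M[R]_(m.-1, n)) : \bar R :=
  ereal_inf [set (lagrangian f lam y)%:E | y in power_set_m Y].

Definition dual_optimal (R : realType) (m n : nat) (Y : set 'rV[R]_n)
    (f : 'I_m -> 'rV[R]_n -> R) (lams : 'M[R]_(m.-1, n)) : Prop :=
  forall lam, (dual_fun Y f lam <= dual_fun Y f lams)%E.

Definition is_argmin (T : Type) (R : realType) (D : set T) (F : T -> R) (y : T) :
    Prop :=
  D y /\ forall z, D z -> F y <= F z.

(* lam, y and r are the sequences of multipliers, exact primal minimizers and
   distortions; gam is the stepsize sequence.  lam 0 is unconstrained. *)
Definition inexact_dual_algorithm (R : realType) (m n : nat) (Y : set 'rV[R]_n)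
    (f : 'I_m -> 'rV[R]_n -> R) (gam : nat -> R) (r y : nat -> 'M[R]_(m, n))
    (lam : nat -> 'M[R]_(m.-1, n)) : Prop :=
  forall k,
    is_argmin (power_set_m Y) (lagrangian f (lam k)) (y k) /\
    lam k.+1 = lam k + gam k *: Aop (y k + r k).

(* The seed is one of the terms, so these are the min and max of a nonempty family. *)
Definition fam_min (R : realType) (m : nat) (m_ge2 : (2 <= m)%N) (a : 'I_m -> R) : R :=
  \big[Num.min/a (Ordinal (ltnW m_ge2))]_(i < m) a i.

Definition fam_max (R : realType) (m : nat) (m_ge2 : (2 <= m)%N) (a : 'I_m -> R) : R :=
  \big[Num.max/a (Ordinal (ltnW m_ge2))]_(i < m) a i.

Definition total_distortion (R : realType) (m : nat) (e : 'I_m -> R) : R :=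
  Num.sqrt (\sum_(i < m.-1) (e (ord_lo i) + e (ord_hi i)) ^+ 2).

(* Main.v *)
Require Import Defs.
From HB Require Import structures.
From mathcomp Require Import all_boot all_order all_algebra.
From mathcomp Require Import all_classical all_reals all_analysis.
From mathcomp Require Import ring lra.
Set Implicit Arguments.
Unset Strict Implicit.
Unset Printing Implicit Defensive.
Import Order.TTheory GRing.Theory Num.Theory.
Import numFieldNormedType.Exports.
Local Open Scope classical_set_scope.
Local Open Scope ring_scope.

(* Shifting the multiplier by [d] changes the Lagrangian by [<d, A z>], so
   everything reduces to two-sided quadratic bounds on the Lagrangian around its
   minimizer [y].  Strong convexity bounds it below; completing the square gives
   [g (l + d) >= g l + <d, A y> - |A^T d|^2 / (2 mu)].  Smoothness bounds it above;
   the trial point [y - A^T d / L] gives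
   [g (l + d) <= g l + <d, A y> - |A^T d|^2 / (2 L)], hence the gradient domination
   inequality [mu_h (g l* - g l) <= |A y|^2 / 2].

   The extreme eigenvalues of [A A^T] come from the weighted AM-GM inequality
   [2 |d_i d_(i+1)| <= (s_(i+1) / s_i) d_i^2 + (s_i / s_(i+1)) d_(i+1)^2] with
   [s_i = sin (i pi / m)], because [s_(i-1) + s_(i+1) = 2 cos (pi / m) s_i].

   With [d = gamma (A y + A r)] and [gamma L_h <= 1] the lower bound shows that
   [- g] increases by at most [gamma (|A r|^2 - |A y|^2) / 2], and gradient domination
   turns the [|A y|^2] term into the contraction factor. *)

(** * Euclidean structure on matrices *)

Section EuclideanSpace.
Variables (R : realType) (p n : nat).
Implicit Types (u v w : 'M[R]_(p, n)) (a : R).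

Lemma dotpC u v : dotp u v = dotp v u.
Proof. by apply: eq_bigr => i _; apply: eq_bigr => j _; rewrite mulrC. Qed.

Lemma dotpDr u v w : dotp u (v + w) = dotp u v + dotp u w.
Proof.
rewrite -big_split; apply: eq_bigr => i _; rewrite -big_split.
by apply: eq_bigr => j _; rewrite mxE mulrDr.
Qed.

Lemma dotpZr a u v : dotp u (a *: v) = a * dotp u v.
Proof.
rewrite big_distrr; apply: eq_bigr => i _; rewrite big_distrr.
by apply: eq_bigr => j _; rewrite mxE /= mulrCA.
Qed.

Lemma dotpNr u v : dotp u (- v) = - dotp u v.
Proof. by rewrite -scaleN1r dotpZr mulN1r. Qed.

Lemma dotpDl u v w : dotp (v + w) u = dotp v u + dotp w u.
Proof. by rewrite ![dotp _ u]dotpC dotpDr. Qed.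

Lemma dotpZl a u v : dotp (a *: v) u = a * dotp v u.
Proof. by rewrite ![dotp _ u]dotpC dotpZr. Qed.

Lemma dotpNl u v : dotp (- v) u = - dotp v u.
Proof. by rewrite ![dotp _ u]dotpC dotpNr. Qed.

Definition dotpE := (dotpDl, dotpDr, dotpNl, dotpNr, dotpZl, dotpZr).

Lemma dotp_ge0 u : 0 <= dotp u u.
Proof. by do 2!apply: sumr_ge0 => ? _; rewrite -expr2 sqr_ge0. Qed.

Lemma sqr_enorm u : enorm u ^+ 2 = dotp u u.
Proof. by rewrite sqr_sqrtr ?dotp_ge0. Qed.

Lemma enorm_ge0 u : 0 <= enorm u.
Proof. exact: sqrtr_ge0. Qed.

Lemma dotpp_eq0 u : dotp u u = 0 -> u = 0.
Proof.
move=> /eqP; rewrite psumr_eq0 => [/allP h|i _]; last first.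
  by apply: sumr_ge0 => j _; rewrite -expr2 sqr_ge0.
apply/matrixP => i j; have := h i (mem_index_enum i).
rewrite psumr_eq0 => [/allP /(_ j (mem_index_enum j))|k _]; last first.
  by rewrite -expr2 sqr_ge0.
by rewrite /= mulf_eq0 orbb mxE => /eqP.
Qed.

(** Cauchy-Schwarz: for nonzero vectors, expand the square of [enorm v *: u - enorm u *: v] and
    cancel the positive factor [enorm u * enorm v]. *)
Lemma dotp_le_enorm u v : dotp u v <= enorm u * enorm v.
Proof.
have [/eqP|nu] := eqVneq (dotp u u) 0.
  by move=> /eqP/dotpp_eq0 ->; rewrite -(scale0r 0) dotpZl mul0r mulr_ge0 ?enorm_ge0.
have [/eqP|nv] := eqVneq (dotp v v) 0.
  by move=> /eqP/dotpp_eq0 ->; rewrite -(scale0r 0) dotpZr mul0r mulr_ge0 ?enorm_ge0.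
have u0 : 0 < enorm u by rewrite sqrtr_gt0 lt_def nu dotp_ge0.
have v0 : 0 < enorm v by rewrite sqrtr_gt0 lt_def nv dotp_ge0.
have := dotp_ge0 (enorm v *: u - enorm u *: v).
rewrite !dotpE (dotpC v u) -!sqr_enorm => h.
rewrite -subr_ge0 -(pmulr_rge0 _ (mulr_gt0 u0 v0)); lra.
Qed.

Lemma dotp_rows u v : dotp u v = \sum_i dotp (row i u) (row i v).
Proof.
by apply: eq_bigr => i _; rewrite /dotp big_ord1; apply: eq_bigr => j _; rewrite !mxE.
Qed.

End EuclideanSpace.

(** * Extreme eigenvalues of the path Laplacian *)

Section PathSpectrum.
Variables (R : realType).

Lemma path_correlation_le (q : nat) (c : R) (s D : nat -> R) :
    s 0%N = 0 -> s q.+2 = 0 -> (forall k, (0 < k < q.+2)%N -> 0 < s k) ->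
    (forall k, s k + s k.+2 = 2 * c * s k.+1) ->
  \sum_(i < q) 2 * `|D i.+1 * D i.+2| <= 2 * c * \sum_(i < q.+1) D i.+1 ^+ 2.
Proof.
move=> s0 sm spos srec.
(* The last term is the part of the budget [2 * c * D k.+1 ^+ 2] already spent on the product of
   [D k] and [D k.+1]. *)
have H k : (k <= q)%N -> \sum_(i < k) 2 * `|D i.+1 * D i.+2| <=
    2 * c * \sum_(i < k) D i.+1 ^+ 2 + s k / s k.+1 * D k.+1 ^+ 2.
  elim: k => [_|k IH kq]; first by rewrite !big_ord0 s0 mulr0 !mul0r addr0.
  rewrite !big_ord_recr /=.
  have a0 : 0 < s k.+1 by apply: spos; rewrite /= !ltnS ltnW.
  have b0 : 0 < s k.+2 by apply: spos.
  apply: le_trans (lerD (IH (ltnW kq)) (lexx _)) _.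
  (* By the recurrence, the unspent share is exactly the weight that AM-GM needs for the next
     product. *)
  have E : s k / s k.+1 = 2 * c - s k.+2 / s k.+1.
    by apply: (mulIf (lt0r_neq0 a0)); rewrite mulrBl !divfK ?lt0r_neq0// -srec addrK.
  rewrite E; set x := D k.+1; set y := D k.+2; set a := s k.+1 in a0 *; set b := s k.+2 in b0 *.
  have : 2 * `|x * y| <= b / a * x ^+ 2 + a / b * y ^+ 2.
    have -> : b / a * x ^+ 2 + a / b * y ^+ 2 =
        2 * `|x * y| + (b * `|x| - a * `|y|) ^+ 2 / (a * b).
      rewrite normrM -(real_normK (num_real x)) -(real_normK (num_real y)).
      by field; rewrite !lt0r_neq0.
    by rewrite lerDl divr_ge0 ?sqr_ge0 ?mulr_ge0 ?ltW.
  lra.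
apply: le_trans (H q (leqnn _)) _.
(* At the far end [s q.+2 = 0], so the recurrence gives [s q / s q.+1 = 2 * c] and the budget is
   used up exactly. *)
rewrite big_ord_recr /= mulrDr lerD2l ler_wpM2r ?sqr_ge0//.
have a0 : 0 < s q.+1 by apply: spos; rewrite /= ltnS.
by have := srec q; rewrite sm addr0 => ->; rewrite mulfK// gt_eqF.
Qed.

Lemma sum_sqr_diff (D : nat -> R) (k : nat) : D 0%N = 0 ->
  \sum_(i < k) (D i.+1 - D i) ^+ 2 =
  2 * \sum_(i < k) D i.+1 ^+ 2 - D k ^+ 2 - 2 * \sum_(i < k) D i * D i.+1.
Proof.
move=> D0; elim: k => [|k IH]; first by rewrite !big_ord0 D0; ring.
by rewrite !big_ord_recr /= IH; ring.
Qed.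

(** The squared differences sum to twice the sum of squares minus twice the neighbour products, so
    one bound on the absolute correlation gives both sides. *)
Lemma path_laplacian_spectrum (q : nat) (D : nat -> R) (c := cos (pi / q.+2%:R)) :
  D 0%N = 0 -> D q.+2 = 0 ->
  (2 - 2 * c) * \sum_(i < q.+1) D i.+1 ^+ 2
    <= \sum_(i < q.+2) (D i.+1 - D i) ^+ 2
    <= (2 + 2 * c) * \sum_(i < q.+1) D i.+1 ^+ 2.
Proof.
move=> D0 Dm; pose t : R := pi / q.+2%:R; pose s (k : nat) := sin (k%:R * t).
have m0 : 0 < q.+2%:R :> R by rewrite ltr0n.
have t0 : 0 < t by rewrite divr_gt0 ?pi_gt0.
have tm : q.+2%:R * t = pi by rewrite mulrC divfK ?lt0r_neq0.
have corr : \sum_(i < q) 2 * `|D i.+1 * D i.+2| <= 2 * c * \sum_(i < q.+1) D i.+1 ^+ 2.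
  apply: (@path_correlation_le q c s); rewrite /s ?mul0r ?sin0 ?tm ?sinpi//.
    move=> k /andP[k0 km]; apply: sin_gt0_pi; rewrite mulr_gt0 ?ltr0n//=.
    by rewrite -tm ltr_pM2r// ltr_nat.
  have sS k : k.+1%:R * t = k%:R * t + t by rewrite -natr1 mulrDl mul1r.
  move=> k; rewrite !sS (sinD (_ + t)) !sinD cosD /c -/t.
  have E : cos t ^+ 2 = 1 - sin t ^+ 2 by rewrite -(cos2Dsin2 t) addrK.
  by ring: E.
(* The first and last products vanish by the boundary values, leaving the [q] interior ones. *)
have norm : `|2 * \sum_(i < q.+2) D i * D i.+1| <= 2 * c * \sum_(i < q.+1) D i.+1 ^+ 2.
  rewrite big_ord_recr big_ord_recl /= Dm D0 mulr0 mul0r add0r addr0.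
  apply: le_trans corr; rewrite mulr_sumr; apply: le_trans (ler_norm_sum _ _ _) _.
  by apply: ler_sum => i _; rewrite normrM ger0_norm.
rewrite sum_sqr_diff// [in X in 2 * X - _]big_ord_recr /= Dm expr0n addr0 subr0.
move: norm; rewrite ler_norml => /andP[]; move: (\sum_(i < _.+2) _) (\sum_(i < _) _) => A B.
by move=> h1 h2; apply/andP; split; lra.
Qed.

Lemma sum_by_parts (D Z : nat -> R) (k : nat) : D 0%N = 0 ->
  \sum_(i < k) D i.+1 * (Z i - Z i.+1) =
  \sum_(i < k.+1) (D i.+1 - D i) * Z i - D k.+1 * Z k.
Proof.
move=> D0; rewrite big_ord_recr /=; elim: k => [|k IH].
  by rewrite !big_ord0 D0; ring.
by rewrite !big_ord_recr /= IH; ring.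
Qed.

End PathSpectrum.

(** * The difference operator and its transpose *)

Section Adjoint.
Variables (R : realType) (n : nat).

(* The [j]-th column of [u], shifted by one and extended by zero on both sides. *)
Definition padcol (p : nat) (u : 'M[R]_(p, n)) (j : 'I_n) (k : nat) : R :=
  if k is k'.+1 then oapp (fun i => u i j) 0 (insub k' : option 'I_p) else 0.

(** The transpose of [Aop]; zero padding lets the first and last rows follow the same formula as the
    others. *)
Definition adjAop (m : nat) (u : 'M[R]_(m.-1, n)) : 'M[R]_(m, n) :=
  \matrix_(i, j) (padcol u j i.+1 - padcol u j i).

Lemma padcolS (p : nat) (u : 'M[R]_(p, n)) j (i : 'I_p) : padcol u j i.+1 = u i j.
Proof. by rewrite /padcol valK. Qed.

Lemma padcol_last (p : nat) (u : 'M[R]_(p, n)) j : padcol u j p.+1 = 0.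
Proof. by rewrite /padcol insubF ?ltnn. Qed.

Lemma dotp_Aop (q : nat) (u : 'M[R]_(q, n)) (z : 'M[R]_(q.+1, n)) :
  dotp u (Aop z) = dotp (adjAop (m := q.+1) u) z.
Proof.
rewrite /dotp exchange_big [RHS]exchange_big; apply: eq_bigr => j _ /=.
pose Z k := z (inord k) j.
transitivity (\sum_(i < q) padcol u j i.+1 * (Z i - Z i.+1)).
  apply: eq_bigr => i _; rewrite padcolS mxE /Z; congr (_ * (z _ _ - z _ _)).
    by apply/val_inj; rewrite /= inordK// ltnS ltnW.
  by apply/val_inj; rewrite /= inordK// ltnS.
rewrite sum_by_parts// padcol_last mul0r subr0.
by apply: eq_bigr => i _; rewrite mxE /Z inord_val.
Qed.

Lemma adjAop_spectrum (q : nat) (u : 'M[R]_(q.+1, n)) (c := cos (pi / q.+2%:R)) :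
  (2 - 2 * c) * dotp u u
    <= dotp (adjAop (m := q.+2) u) (adjAop (m := q.+2) u)
    <= (2 + 2 * c) * dotp u u.
Proof.
have E : dotp u u = \sum_j \sum_(i < q.+1) padcol u j i.+1 ^+ 2.
  rewrite /dotp exchange_big; apply: eq_bigr => j _; apply: eq_bigr => i _.
  by rewrite padcolS.
have F : dotp (adjAop (m := q.+2) u) (adjAop (m := q.+2) u) =
    \sum_j \sum_(i < q.+2) (padcol u j i.+1 - padcol u j i) ^+ 2.
  rewrite /dotp exchange_big; apply: eq_bigr => j _; apply: eq_bigr => i _.
  by rewrite !mxE.
have H j := path_laplacian_spectrum (erefl (padcol u j 0)) (padcol_last u j).
rewrite E F !mulr_sumr; apply/andP; split; apply: ler_sum => j _; by case/andP: (H j).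
Qed.

Lemma AopD (m : nat) (y z : 'M[R]_(m, n)) : Aop (y + z) = Aop y + Aop z.
Proof. by apply/matrixP => i j; rewrite !mxE; ring. Qed.

Lemma AopZ (m : nat) a (y : 'M[R]_(m, n)) : Aop (a *: y) = a *: Aop y.
Proof. by apply/matrixP => i j; rewrite !mxE; ring. Qed.

Lemma dotp_Aop_le (m : nat) (e : 'I_m -> R) (r : 'M[R]_(m, n)) :
  (forall i, enorm (row i r) <= e i) ->
  dotp (Aop r) (Aop r) <= total_distortion e ^+ 2.
Proof.
move=> re; have e0 i : 0 <= e i by apply: le_trans (re i); apply: enorm_ge0.
rewrite /total_distortion sqr_sqrtr; last first.
  by apply: sumr_ge0 => i _; rewrite sqr_ge0.
rewrite dotp_rows; apply: ler_sum => i _.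
have -> : row i (Aop r) = row (ord_lo i) r - row (ord_hi i) r.
  by apply/rowP => j; rewrite !mxE.
set u := row _ r; set v := row _ r.
apply: (@le_trans _ _ ((enorm u + enorm v) ^+ 2)).
  rewrite !dotpE (dotpC v u) -!sqr_enorm.
  have := dotp_le_enorm (- u) v; rewrite dotpNl /enorm dotpNl dotpNr opprK -!/(enorm _); lra.
by rewrite lerXn2r ?nnegrE ?addr_ge0 ?enorm_ge0// lerD /u /v.
Qed.

End Adjoint.

(** * Quadratic inequalities for a single function *)

Section StrongConvexityAndSmoothness.
Variables (R : realType) (n : nat).
Implicit Types (phi : 'rV[R]_n -> R) (x z v : 'rV[R]_n).

Lemma strongly_convexP (s : R) phi x z (t : R) : strongly_convex s phi ->
  0 <= t -> t <= 1 ->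
  phi (t *: x + (1 - t) *: z) <=
    t * phi x + (1 - t) * phi z - s / 2 * (t * (1 - t)) * dotp (x - z) (x - z).
Proof.
move=> sc t0 t1; have := sc (Itv01 t0 t1) x z (in_setT _) (in_setT _).
rewrite !convRE /= !sqr_enorm.
have -> : conv (Itv01 t0 t1) (x : convex_lmodType _) z = t *: x + (1 - t) *: z by [].
rewrite /unstable.onem !dotpE (dotpC z x); lra.
Qed.

Lemma derive_grad phi x v : differentiable phi x -> 'D_v phi x = dotp (grad phi x) v.
Proof.
move=> df; rewrite deriveE// [in LHS](row_sum_delta v) linear_sum /dotp big_ord1.
by apply: eq_bigr => j _; rewrite linearZ /= mxE deriveE// mulrC.
Qed.

Lemma is_derive_line phi x v (t : R) : differentiable phi (x + t *: v) ->
  is_derive t 1 (fun t => phi (x + t *: v)) (dotp (grad phi (x + t *: v)) v).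
Proof.
move=> df; have dv : derivable phi (x + t *: v) v by apply: diff_derivable.
have E : (fun h : R => h^-1 *: (phi (x + (h *: 1 + t) *: v) - phi (x + t *: v))) =
    (fun h : R => h^-1 *: (phi (h *: v + (x + t *: v)) - phi (x + t *: v))).
  apply/funext => h; congr (_ *: (phi _ - _)).
  by rewrite scalerDl -scalerA scale1r addrCA.
split; first by rewrite /derivable E.
by rewrite -derive_grad// /derive E.
Qed.

(** Descent lemma: [psi] subtracts the growth of the quadratic model from [phi] along the segment.
    Cauchy-Schwarz and the Lipschitz bound make its derivative nonpositive on [0, 1], and the mean
    value theorem concludes. *)
Lemma lipschitz_grad_le (L : R) phi x v : (forall x, differentiable phi x) ->
  lipschitz_grad L phi ->
  phi (x + v) <= phi x + dotp (grad phi x) v + L / 2 * dotp v v.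
Proof.
move=> df lip.
pose psi (t : R) := phi (x + t *: v) - t * dotp (grad phi x) v - t ^+ 2 * (L / 2 * dotp v v).
pose dpsi (t : R) := dotp (grad phi (x + t *: v)) v - dotp (grad phi x) v - 2 * t * (L / 2 * dotp v v).
have dpsiP (t : R) : is_derive t 1 psi (dpsi t).
  have ? := is_derive_line (df (x + t *: v)).
  rewrite /psi /dpsi; apply: is_derive_eq; rewrite !scaler0 ?add0r /GRing.scale /=; ring.
have [c /andP[c0 c1] E] : exists2 c, c \in `[0, 1]%R & psi 1 - psi 0 = dpsi c * (1 - 0).
  apply: MVT_segment => //.
  apply: continuous_subspaceT => t; apply: differentiable_continuous.
  by apply/derivable1_diffP; apply: ex_derive.
have {}c1 : c <= 1 by [].
have {}c0 : 0 <= c by [].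
have : dpsi c <= 0.
  have : dotp (grad phi (x + c *: v) - grad phi x) v <= c * L * dotp v v.
    apply: le_trans (dotp_le_enorm _ _) _.
    apply: (@le_trans _ _ (L * enorm (c *: v) * enorm v)).
      by rewrite ler_wpM2r ?enorm_ge0//; have := lip (x + c *: v) x; rewrite (addrC x) addrK.
    rewrite [enorm (c *: v)]/enorm dotpZl dotpZr mulrA -expr2 sqrtrM ?sqr_ge0//.
    rewrite sqrtr_sqr ger0_norm// -/(enorm v) -sqr_enorm; lra.
  rewrite /dpsi dotpDl dotpNl; lra.
rewrite subr0 mulr1 in E; rewrite -E /psi scale0r scale1r addr0; lra.
Qed.

End StrongConvexityAndSmoothness.

(** * Quadratic bounds on the dual function *)

Section DualFunction.
Variables (R : realType) (q n : nat) (f : 'I_q.+2 -> 'rV[R]_n -> R).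
Implicit Types (l d : 'M[R]_(q.+1, n)) (y z w : 'M[R]_(q.+2, n)).

Let c : R := cos (pi / q.+2%:R).

Lemma lagrangianD l d z :
  lagrangian f (l + d) z = lagrangian f l z + dotp d (Aop z).
Proof. by rewrite /lagrangian dotpDl addrA. Qed.

Section StronglyConvex.
Variables (mu_ : 'I_q.+2 -> R) (mu : R).
Hypotheses (mu_gt0 : 0 < mu) (mu_le : forall i, mu <= mu_ i).
Hypothesis f_strong : forall i, strongly_convex (mu_ i) (f i).

Lemma lagrangian_strongly_convex l y z (t : R) : 0 <= t -> t <= 1 ->
  lagrangian f l (t *: z + (1 - t) *: y) <=
    t * lagrangian f l z + (1 - t) * lagrangian f l y
    - mu / 2 * (t * (1 - t)) * dotp (z - y) (z - y).
Proof.
move=> t0 t1; rewrite /lagrangian AopD !AopZ dotpDr !dotpZr.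
have : \sum_i f i (row i (t *: z + (1 - t) *: y)) <=
    \sum_i (t * f i (row i z) + (1 - t) * f i (row i y)
            - mu / 2 * (t * (1 - t)) * dotp (row i (z - y)) (row i (z - y))).
  apply: ler_sum => i _; have -> : row i (z - y) = row i z - row i y by rewrite linearB.
  have -> : row i (t *: z + (1 - t) *: y) = t *: row i z + (1 - t) *: row i y.
    by rewrite linearD !linearZ.
  apply: le_trans (strongly_convexP _ _ (f_strong i) t0 t1) _.
  rewrite lerD2l lerN2 ler_wpM2r ?dotp_ge0// ler_wpM2r ?ler_pM2r//.
  by rewrite mulr_ge0// subr_ge0.
rewrite sumrB big_split /= -!mulr_sumr -dotp_rows; lra.
Qed.

(** Minimality against the points of the segment from [y] to [z] gives [(1 - t) * a <= b] for 0 < t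
    <= 1; small [t] then forces [a <= b]. *)
Lemma argmin_quadratic_growth l y z :
  (forall z, lagrangian f l y <= lagrangian f l z) ->
  lagrangian f l y + mu / 2 * dotp (z - y) (z - y) <= lagrangian f l z.
Proof.
move=> ymin; set a := mu / 2 * _; set b := lagrangian f l z - lagrangian f l y.
have b0 : 0 <= b by rewrite subr_ge0.
have ab t : 0 < t -> t <= 1 -> (1 - t) * a <= b.
  move=> t0 t1; rewrite -(ler_pM2l t0).
  have := lagrangian_strongly_convex l y z (ltW t0) t1.
  have := ymin (t *: z + (1 - t) *: y); rewrite /a /b; lra.
suff : a <= b by rewrite /b; lra.
clearbody a b; rewrite leNgt; apply/negP => ba; have a0 : 0 < a by apply: le_lt_trans ba.
(* This [t] is half the threshold [1 - b / a]: it makes [(1 - t) * a] the midpoint of [a] and [b],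
   which exceeds [b]. *)
have t0 : 0 < (a - b) / (2 * a) by apply: divr_gt0; lra.
have t1 : (a - b) / (2 * a) <= 1 by rewrite ler_pdivrMr ?mulr_gt0//; lra.
have := ab _ t0 t1.
have -> : (1 - (a - b) / (2 * a)) * a = (a + b) / 2 by field; rewrite gt_eqF.
lra.
Qed.

Lemma dual_ascent l d y z :
  (forall z, lagrangian f l y <= lagrangian f l z) ->
  lagrangian f l y + dotp d (Aop y) - 1 / mu * (2 + 2 * c) / 2 * dotp d d
    <= lagrangian f (l + d) z.
Proof.
move=> ymin; have := argmin_quadratic_growth z ymin.
have [w zw] : exists w, z = y + w by exists (z - y); rewrite addrC subrK.
have -> : z - y = w by rewrite zw addrC addKr.
rewrite lagrangianD [in Aop z]zw AopD dotpDr (dotp_Aop d w) => grow.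
set a := adjAop _.
have /andP[_] := adjAop_spectrum d; rewrite -/a -/c => spec.
have sq : 0 <= dotp (mu *: w + a) (mu *: w + a) := dotp_ge0 _.
rewrite !dotpE (dotpC w a) in sq.
have : - (dotp a a / (2 * mu)) <= mu / 2 * dotp w w + dotp a w.
  rewrite lerNl ler_pdivlMr ?mulr_gt0//; lra.
have : dotp a a / (2 * mu) <= 1 / mu * (2 + 2 * c) / 2 * dotp d d.
  rewrite ler_pdivrMr ?mulr_gt0//.
  suff -> : 1 / mu * (2 + 2 * c) / 2 * dotp d d * (2 * mu) = (2 + 2 * c) * dotp d d by [].
  by field; rewrite gt_eqF.
lra.
Qed.

End StronglyConvex.

Section Smooth.
Variables (L_ : 'I_q.+2 -> R) (L : R).
Hypotheses (L_gt0 : 0 < L) (L_ge : forall i, L_ i <= L).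
Hypothesis f_diff : forall i x, differentiable (f i) x.
Hypothesis f_lip : forall i, lipschitz_grad (L_ i) (f i).

Let slope l y w := \sum_i dotp (grad (f i) (row i y)) (row i w) + dotp l (Aop w).

Let slopeZ l y a w : slope l y (a *: w) = a * slope l y w.
Proof.
rewrite /slope AopZ dotpZr mulrDr; congr (_ + _); rewrite mulr_sumr.
by apply: eq_bigr => i _; rewrite linearZ dotpZr.
Qed.

Let lagrangian_smooth l y w : lagrangian f l (y + w) <=
  lagrangian f l y + slope l y w + L / 2 * dotp w w.
Proof.
rewrite /lagrangian /slope AopD dotpDr.
have : \sum_i f i (row i (y + w)) <=
    \sum_i (f i (row i y) + dotp (grad (f i) (row i y)) (row i w)
            + L / 2 * dotp (row i w) (row i w)).
  apply: ler_sum => i _; rewrite linearD /=.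
  apply: le_trans (lipschitz_grad_le _ _ (f_diff i) (f_lip i)) _.
  by rewrite lerD2l ler_wpM2r ?dotp_ge0// ler_pM2r.
rewrite !big_split /= -mulr_sumr -dotp_rows; lra.
Qed.

(* The smoothness bound along [t *: w] replaces Fermat's rule: minimality forces
   [0 <= t * slope + t ^+ 2 * K] for all [t], hence [slope = 0]. *)
Lemma argmin_quadratic_upper_bound l y w :
  (forall z, lagrangian f l y <= lagrangian f l z) ->
  lagrangian f l (y + w) <= lagrangian f l y + L / 2 * dotp w w.
Proof.
move=> ymin; pose K := L / 2 * dotp w w; pose G := slope l y w.
have K0 : 0 <= K by rewrite mulr_ge0 ?dotp_ge0 ?divr_ge0 ?ltW.
have quad t : 0 <= t * G + t ^+ 2 * K.
  have := lagrangian_smooth l y (t *: w); have := ymin (y + t *: w).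
  rewrite slopeZ -/G dotpZl dotpZr /K; lra.
suff G0 : G = 0 by have := lagrangian_smooth l y w; rewrite -/G G0 addr0.
have k1 : 0 < 2 * K + 1 by lra.
(* Near the minimizer [- G / (2 * K)] of the quadratic; the added 1 keeps the denominator positive
   when [K = 0], and the value stays negative unless [G = 0]. *)
have := quad (- G / (2 * K + 1)).
have -> : - G / (2 * K + 1) * G + (- G / (2 * K + 1)) ^+ 2 * K =
    - (G ^+ 2 * ((K + 1) / (2 * K + 1) ^+ 2)) by field; rewrite gt_eqF.
rewrite oppr_ge0 pmulr_lle0; last by rewrite divr_gt0 ?exprn_gt0//; lra.
by rewrite real_exprn_even_le0 ?num_real//= => /eqP.
Qed.

Lemma dual_concave_upper_bound l d y :
  (forall z, lagrangian f l y <= lagrangian f l z) ->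
  exists z, lagrangian f (l + d) z <=
    lagrangian f l y + dotp d (Aop y) - 1 / L * (2 - 2 * c) / 2 * dotp d d.
Proof.
(* This [w] minimizes [L / 2 * dotp w w + dotp a w]. *)
move=> ymin; set a := adjAop (m := q.+2) d; pose w := - L^-1 *: a.
exists (y + w); rewrite lagrangianD AopD dotpDr (dotp_Aop d w) -/a.
have := argmin_quadratic_upper_bound w ymin.
have /andP[spec _] := adjAop_spectrum d; rewrite -/a -/c in spec.
have -> : dotp w w = L^-1 ^+ 2 * dotp a a by rewrite /w dotpZl dotpZr; ring.
have -> : dotp a w = - (L^-1 * dotp a a) by rewrite /w dotpZr; ring.
have -> : L / 2 * (L^-1 ^+ 2 * dotp a a) = L^-1 / 2 * dotp a a.
  by field; rewrite gt_eqF.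
have : L^-1 / 2 * ((2 - 2 * c) * dotp d d) <= L^-1 / 2 * dotp a a.
  by rewrite ler_pM2l// divr_gt0 ?invr_gt0.
lra.
Qed.

(** Polyak-Lojasiewicz inequality: the upper model at [d = ls - l] is a concave quadratic in [d],
    and [|k d - A y|^2 >= 0] bounds it independently of [d]. *)
Lemma dual_gradient_dominated l ls y (gs : R) :
  (forall z, lagrangian f l y <= lagrangian f l z) ->
  (forall z, gs <= lagrangian f ls z) ->
  1 / L * (2 - 2 * c) * (gs - lagrangian f l y) <= dotp (Aop y) (Aop y) / 2.
Proof.
move=> ymin gs_le; have [z] := dual_concave_upper_bound (ls - l) ymin.
rewrite [l + _]addrC subrK; set d := ls - l; set k := 1 / L * _ => zle.
have k0 : 0 <= k.
  by apply: mulr_ge0; rewrite ?divr_ge0 ?(ltW L_gt0)// subr_ge0 ler_piMr// cos_le1.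
have : k * (gs - lagrangian f l y) <= k * (dotp d (Aop y) - k / 2 * dotp d d).
  by rewrite ler_wpM2l//; have := gs_le z; lra.
clearbody d; have := dotp_ge0 (k *: d - Aop y); rewrite !dotpE (dotpC (Aop y) d); lra.
Qed.

End Smooth.

End DualFunction.

(** * Attained dual values and the one-step contraction *)

Lemma dual_fun_argmin (R : realType) (m n : nat) (f : 'I_m -> 'rV[R]_n -> R) l y :
  (forall z, lagrangian f l y <= lagrangian f l z) ->
  dual_fun setT f l = (lagrangian f l y)%:E.
Proof.
move=> ymin; apply/eqP; rewrite eq_le; apply/andP; split.
  by apply: ereal_inf_lbound; exists y.
by apply/ereal_infP => _ [z _ <-]; rewrite lee_fin.
Qed.

Lemma dual_fun_le (R : realType) (m n : nat) (f : 'I_m -> 'rV[R]_n -> R) l z :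
  (dual_fun setT f l <= (lagrangian f l z)%:E)%E.
Proof. by apply: ereal_inf_lbound; exists z. Qed.

Theorem lemma3 (R : realType) (m n : nat) (m_ge2 : (2 <= m)%N) (n_ge1 : (1 <= n)%N)
    (f : 'I_m -> 'rV[R]_n -> R) (mu_ L_ e : 'I_m -> R)
    (f_strict : forall i, strictly_convex (f i))
    (f_closed : forall i, closed_function (f i))
    (mu_gt0 : forall i, 0 < mu_ i)
    (f_strong : forall i, strongly_convex (mu_ i) (f i))
    (f_diff : forall i x, differentiable (f i) x)
    (L_gt0 : forall i, 0 < L_ i)
    (f_lip : forall i, lipschitz_grad (L_ i) (f i))
    (lams : 'M[R]_(m.-1, n)) (lams_opt : dual_optimal setT f lams)
    (gam : nat -> R) (r y : nat -> 'M[R]_(m, n)) (lam : nat -> 'M[R]_(m.-1, n))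
    (run : inexact_dual_algorithm setT f gam r y lam)
    (r_bound : forall i k, enorm (row i (r k)) <= e i) :
  let mu := fam_min m_ge2 mu_ in
  let L := fam_max m_ge2 L_ in
  let Lh := 1 / mu * (2 + 2 * cos (pi / m%:R)) in
  let muh := 1 / L * (2 - 2 * cos (pi / m%:R)) in
  let eps := total_distortion e in
  let h := fun l : 'M[R]_(m.-1, n) => (- dual_fun setT f l)%E in
  (forall k, 0 < gam k /\ gam k <= 1 / Lh) ->
  forall k,
    (h (lam k.+1) - h lams
      <= (1 - gam k * muh)%:E * (h (lam k) - h lams)
         + (gam k * eps ^+ 2 / 2)%:E)%E.
Proof.
move: m m_ge2 f mu_ L_ e f_strict f_closed mu_gt0 f_strong f_diff L_gt0 f_lip
  lams lams_opt r y lam run r_bound.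
case=> [//|[//|q]] m_ge2 f mu_ L_ e _ _ mu_gt0 f_strong f_diff L_gt0 f_lip
  lams lams_opt r y lam run r_bound mu L Lh muh eps h gam_ok k.
have mu0 : 0 < mu by apply: lt_bigmin.
have mule i : mu <= mu_ i by apply: bigmin_le.
have Lge i : L_ i <= L by apply: le_bigmax.
have L0 : 0 < L by apply: lt_le_trans (L_gt0 ord0) (Lge _).
have ymin j z : lagrangian f (lam j) (y j) <= lagrangian f (lam j) z.
  by have [[_ ym] _] := run j; apply: ym.
have hE j : h (lam j) = (- lagrangian f (lam j) (y j))%:E.
  by rewrite /h (dual_fun_argmin (ymin j)).
(* The optimal value is finite: the attained dual value at [lam k] bounds it below, the Lagrangian
   at 0 above. *)
have [gs gsE] : exists gs, dual_fun setT f lams = gs%:E.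
  have := lams_opt (lam k); rewrite (dual_fun_argmin (ymin k)).
  have := dual_fun_le f lams 0.
  by case: (dual_fun _ _ lams) => [gs _ _|//|//]; exists gs.
have gs_le z : gs <= lagrangian f lams z by rewrite -lee_fin -gsE dual_fun_le.
rewrite !hE /h gsE -!EFinN -!EFinD lee_fin.
have [g0 gLh] := gam_ok k.
have [_ lamS] := run k.
have := dual_ascent mu0 mule f_strong (gam k *: Aop (y k + r k)) (y k.+1) (ymin k).
rewrite -lamS AopD -/Lh !dotpE.
have := dual_gradient_dominated L0 Lge f_diff f_lip (ymin k) gs_le; rewrite -/muh.
have := dotp_Aop_le (fun i => r_bound i k); rewrite -/eps.
set g := gam k; set d := Aop (y k); set s := Aop (r k).
set hk := lagrangian f (lam k) _; set hk1 := lagrangian _ _ _.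
rewrite (dotpC s d) => noise pl ascent.
have Lg : g * Lh <= 1.
  (* Positivity of [Lh] follows from the stepsize condition itself: [0 < gam k <= 1 / Lh]. *)
  have Lh0 : 0 < Lh.
    by have := lt_le_trans g0 gLh; rewrite div1r invr_gt0.
  by rewrite -ler_pdivlMr.
have N : 0 <= dotp (d + s) (d + s) := dotp_ge0 _.
(* With this bound the cross terms cancel: [g <d + s, d> - g / 2 |d + s|^2 = g / 2 (|d|^2 -
   |s|^2)]. *)
have q1 : g / 2 * (g * Lh) * dotp (d + s) (d + s) <= g / 2 * 1 * dotp (d + s) (d + s).
  by rewrite ler_wpM2r// ler_pM2l// divr_gt0.
have q2 : g * (muh * (gs - hk)) <= g * (dotp d d / 2) by rewrite ler_pM2l.
have q3 : g / 2 * dotp s s <= g / 2 * eps ^+ 2 by rewrite ler_pM2l// divr_gt0.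
rewrite !dotpE (dotpC s d) in q1.
lra.
Qed.
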